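(* Let $E\ge 1$ be the number of subcircuit configurations of a cut circuit, let $P$ be the ground-truth probabilities and $\Theta$ a set of cut parameters, and let $f_e=f_e(P,\Theta)\ge 0$, $e=1,\dots,E$, be the associated variance coefficients, not all zero. Let $\epsilon>0$, and let $N_{\mathrm{even}}$ and $N_{\mathrm{opt}}$ denote the total number of shots required to achieve estimation error $\epsilon$ under the even and the optimal shot distribution schemes, respectively. Then $$1\le\frac{N_{\mathrm{even}}}{N_{\mathrm{opt}}}\le E.$$
   Context: If configuration $e$ is sampled with $N_e$ shots, the estimation error (total variance of the reconstructed outcome probabilities) is $\mathrm{Err}=\sum_{e=1}^{E}\frac{1}{N_e}f_e(P,\Theta)$, where the coefficients $f_e(P,\Theta)\ge 0$ do not depend on the shot numbers. Shot numbers are treated as nonnegative real numbers, and a term with $f_e=0$ contributes $0$ to $\mathrm{Err}$ even if $N_e=0$. For a total number of shots $N=\sum_e N_e$: the even shot distribution is $N_e=N/E$ for all $e$; the optimal shot distribution is $N_e=N\,\sqrt{f_e(P,\Theta)}\big/\sum_{e'=1}^{E}\sqrt{f_{e'}(P,\Theta)}$. The number of shots required to achieve estimation error $\epsilon$ under a scheme is the total $N$ for which $\mathrm{Err}=\epsilon$; thus $$N_{\mathrm{even}}=\frac{E}{\epsilon}\sum_{e=1}^{E}f_e(P,\Theta),\qquad N_{\mathrm{opt}}=\frac{1}{\epsilon}\Bigl(\sum_{e=1}^{E}\sqrt{f_e(P,\Theta)}\Bigr)^2 .$$ *)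

(* Defs.v *)
From HB Require Import structures.
From mathcomp Require Import all_boot all_order all_algebra.
From mathcomp Require Import boolp classical_sets reals constructive_ereal.

Set Implicit Arguments.
Unset Strict Implicit.
Unset Printing Implicit Defensive.

Import Order.TTheory GRing.Theory Num.Theory.
Local Open Scope classical_set_scope.
Local Open Scope ring_scope.

(* The error is extended-real valued: on [\bar R] one has 0^-1 = +oo and
   0 * +oo = 0, so a configuration with f e = 0 contributes 0 even when it
   receives no shots, whereas one with f e > 0 and no shots makes the error
   infinite (real division, with x / 0 = 0, would wrongly make it vanish). *)
Definition estimation_error (R : realType) (E : nat) (f shots : 'I_E -> R)
    : \bar R :=
  (\sum_(e < E) ((shots e)%:E^-1 * (f e)%:E))%E.

Definition even_shots (R : realType) (E : nat) (N : R) : 'I_E -> R :=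
  fun=> N / E%:R.

Definition optimal_shots (R : realType) (E : nat) (f : 'I_E -> R) (N : R)
    : 'I_E -> R :=
  fun e => N * Num.sqrt (f e) / \sum_(e' < E) Num.sqrt (f e').

(* The total N >= 0 for which the error equals eps, when a total N is
   distributed according to [scheme]. For eps > 0, coefficients f that are
   nonnegative and not all zero, and either of the two schemes above, exactly
   one such N exists; the default value 0 of [xget] is then irrelevant. *)
Definition required_shots (R : realType) (E : nat) (f : 'I_E -> R)
    (scheme : R -> 'I_E -> R) (eps : R) : R :=
  xget 0 [set N : R | 0 <= N /\ estimation_error f (scheme N) = eps%:E].

Definition N_even (R : realType) (E : nat) (f : 'I_E -> R) (eps : R) : R :=
  required_shots f (@even_shots R E) eps.

Definition N_opt (R : realType) (E : nat) (f : 'I_E -> R) (eps : R) : R :=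
  required_shots f (optimal_shots f) eps.

(* Main.v *)
(* With shots N * w e the error is (\sum_e f e / w e) / N, so the required
   total is (\sum_e f e / w e) / eps. Hence the ratio is
   E * \sum_e f e / (\sum_e sqrt (f e))^2, which Cauchy-Schwarz bounds below
   by 1; it is at most E since the cross terms in the squared sum are
   nonnegative. *)
Require Import Defs.
From HB Require Import structures.
From mathcomp Require Import all_boot all_order all_algebra.
From mathcomp Require Import boolp classical_sets reals constructive_ereal.
From mathcomp Require Import ring.

Import Order.TTheory GRing.Theory Num.Theory.
Local Open Scope ring_scope.

(** Cauchy-Schwarz against the constant vector, obtained from the nonnegativity of a variance. The
    deviations from the mean are scaled by [n] to avoid division. *)
Lemma sqr_sum_le_card_sum_sqr (R : realFieldType) (n : nat) (s : 'I_n -> R) :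
  (\sum_i s i) ^+ 2 <= n%:R * \sum_i s i ^+ 2.
Proof.
case: n s => [|n] s; first by rewrite big_ord0 expr0n mul0r.
set S := \sum_i s i; set Q := \sum_i s i ^+ 2; set c : R := n.+1%:R.
have c_gt0 : 0 < c by rewrite ltr0n.
have dev_ge0 : 0 <= \sum_i (c * s i - S) ^+ 2.
  by apply: sumr_ge0 => i _; rewrite sqr_ge0.
have devE : \sum_i (c * s i - S) ^+ 2 = c * (c * Q - S ^+ 2).
  have sqrE i :
      (c * s i - S) ^+ 2 = c ^+ 2 * s i ^+ 2 - 2 * c * S * s i + S ^+ 2.
    by ring.
  under eq_bigr do rewrite sqrE.
  rewrite big_split sumrB /= -!mulr_sumr sumr_const card_ord -/S -/Q.
  by rewrite -mulr_natl -/c; ring.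
by rewrite devE pmulr_rge0 // subr_ge0 in dev_ge0.
Qed.

Lemma sum_sqr_le_sqr_sum (R : realDomainType) (n : nat) (s : 'I_n -> R) :
  (forall i, 0 <= s i) -> \sum_i s i ^+ 2 <= (\sum_i s i) ^+ 2.
Proof.
move=> s_ge0; rewrite [leRHS]expr2 mulr_suml; apply: ler_sum => i _.
rewrite expr2 ler_wpM2l // (bigD1 i) //= lerDl.
by apply: sumr_ge0.
Qed.

Section ProportionalScheme.
Context {R : realType} {E : nat}.
Variables f w : 'I_E -> R.
Hypothesis f_ge0 : forall e, 0 <= f e.
Hypothesis w_gt0 : forall e, f e != 0 -> 0 < w e.

(** Where [f e = 0] both summands vanish whatever [w e] is, so positive weights are assumed only
    elsewhere: the optimal weights vanish together with [f]. *)
Lemma estimation_error_proportional (N : R) : 0 < N ->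
  estimation_error f (fun e => N * w e) = ((\sum_e f e / w e) / N)%:E.
Proof.
move=> N_gt0; rewrite /estimation_error mulr_suml -sumEFin.
apply: eq_bigr => e _; have [->|fe_neq0] := eqVneq (f e) 0.
  by rewrite mule0 !mul0r.
have we_gt0 := w_gt0 _ fe_neq0.
rewrite inver mulf_eq0 !gt_eqF //= -EFinM; congr EFin.
by rewrite invfM; ring.
Qed.

(** A nonzero coefficient contributes [+oo] and no term is negative. This rules out a zero total
    when the required number of shots is shown to be unique. *)
Lemma estimation_error_no_shots : (exists e, f e != 0) ->
  estimation_error f (fun=> 0) = +oo%E.
Proof.
move=> [e fe_neq0]; apply/eqP; rewrite -leye_eq /estimation_error.
rewrite (bigD1 e) //= inve0 gt0_mulye ?lte_fin ?lt_def ?fe_neq0 ?f_ge0 //.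
rewrite leeDl // sume_ge0 // => i _.
by rewrite mule_ge0 ?leey ?lee_fin.
Qed.

Lemma required_shots_proportional (scheme : R -> 'I_E -> R) (eps : R) :
  (exists e, f e != 0) -> 0 < eps -> (forall N e, scheme N e = N * w e) ->
  required_shots f scheme eps = (\sum_e f e / w e) / eps.
Proof.
move=> f_neq0 eps_gt0 scheme_lin.
have schemeE N : scheme N = fun e => N * w e by exact/funext.
set S := \sum_e f e / w e.
have S_gt0 : 0 < S.
  have [e fe_neq0] := f_neq0.
  rewrite /S (bigD1 e) //= ltr_pwDl //.
    by rewrite divr_gt0 ?w_gt0 // lt_def fe_neq0 f_ge0.
  apply: sumr_ge0 => i _; have [->|/w_gt0/ltW wi_ge0] := eqVneq (f i) 0.
    by rewrite mul0r.
  by rewrite divr_ge0.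
(* Two goals: [S / eps] attains the error [eps], and any total attaining it equals [S / eps]. *)
apply: xget_unique => /= [|N [N_ge0]].
  rewrite schemeE estimation_error_proportional ?divr_gt0 // -/S.
  split; first by rewrite ltW // divr_gt0.
  by rewrite invf_div mulrCA divff ?mulr1 // gt_eqF.
rewrite schemeE; have [->|N_neq0] := eqVneq N 0.
  under eq_fun do rewrite mul0r.
  by rewrite estimation_error_no_shots.
rewrite estimation_error_proportional ?lt_def ?N_neq0 // => -[<-].
by rewrite -/S invf_div mulrCA divff ?mulr1 // gt_eqF.
Qed.

End ProportionalScheme.

Section RequiredShots.
Context {R : realType} {E : nat}.
Variables (f : 'I_E -> R) (eps : R).
Hypothesis f_ge0 : forall e, 0 <= f e.
Hypothesis f_neq0 : exists e, f e != 0.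
Hypothesis eps_gt0 : 0 < eps.

Lemma sum_sqrt_gt0 : 0 < \sum_e Num.sqrt (f e).
Proof.
have [e fe_neq0] := f_neq0; rewrite (bigD1 e) //= ltr_pwDl //.
  by rewrite sqrtr_gt0 lt_def fe_neq0 f_ge0.
by apply: sumr_ge0 => i _; rewrite sqrtr_ge0.
Qed.

Lemma N_evenE : N_even f eps = E%:R / eps * \sum_e f e.
Proof.
have E_gt0 : (0 < E)%N by have [e _] := f_neq0; exact: leq_ltn_trans (ltn_ord e).
rewrite /N_even (@required_shots_proportional _ _ f (fun=> E%:R^-1)) //.
  by rewrite -mulr_suml invrK; ring.
by move=> e _; rewrite invr_gt0 ltr0n.
Qed.

Lemma N_optE : N_opt f eps = (\sum_e Num.sqrt (f e)) ^+ 2 / eps.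
Proof.
have S_gt0 := sum_sqrt_gt0; set S := \sum_e _ in S_gt0 *.
rewrite /N_opt (@required_shots_proportional _ _ f
  (fun e => Num.sqrt (f e) / S)) //; last first.
- by move=> N e; rewrite /optimal_shots mulrA.
- by move=> e fe_neq0; rewrite divr_gt0 // sqrtr_gt0 lt_def fe_neq0 f_ge0.
(* Termwise, [f e / w e] equals [S * Num.sqrt (f e)]; when [f e = 0] both sides are zero. *)
congr (_ / _); rewrite expr2 {2}/S mulr_sumr; apply: eq_bigr => e _.
rewrite invf_div mulrCA; congr (_ * _).
have [fe0|fe_neq0] := eqVneq (f e) 0; first by rewrite fe0 mul0r sqrtr0.
rewrite -{1}(sqr_sqrtr (f_ge0 e)) expr2 mulfK // gt_eqF //.
by rewrite sqrtr_gt0 lt_def fe_neq0 f_ge0.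
Qed.

End RequiredShots.

Theorem lemmaV2 (R : realType) (E : nat) (Prob CutParam : Type)
    (f : 'I_E -> Prob -> CutParam -> R) (P : Prob) (Theta : CutParam) (eps : R)
    (E_ge1 : (1 <= E)%N)
    (f_ge0 : forall e : 'I_E, 0 <= f e P Theta)
    (f_neq0 : exists e : 'I_E, f e P Theta != 0)
    (eps_gt0 : 0 < eps) :
  1 <= N_even (fun e => f e P Theta) eps / N_opt (fun e => f e P Theta) eps
  /\ N_even (fun e => f e P Theta) eps / N_opt (fun e => f e P Theta) eps
     <= E%:R.
Proof.
have S_gt0 := sum_sqrt_gt0 _ f_ge0 f_neq0.
rewrite N_evenE // N_optE // ler_pdivlMr ?ler_pdivrMr ?divr_gt0 ?exprn_gt0 //.
(* The factor [eps^-1] cancels, leaving two inequalities between the sum of the coefficients and the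
   squared sum of their roots. *)
rewrite mul1r (mulrAC E%:R) (mulrA E%:R) !ler_pM2r ?invr_gt0 //.
have sqrE : \sum_e f e P Theta = \sum_e Num.sqrt (f e P Theta) ^+ 2.
  by apply: eq_bigr => e _; rewrite sqr_sqrtr.
rewrite sqrE; split; first exact: sqr_sum_le_card_sum_sqr.
rewrite ler_wpM2l ?ler0n //; apply: sum_sqr_le_sqr_sum => e.
exact: sqrtr_ge0.
Qed.
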